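(* Let $(U_n)_{n\ge0}$ be a VLMC defined by a probabilized bamboo blossom context tree, with data $(q_{(01)^n1})_{n\ge0}$, $(q_{(01)^n00})_{n\ge0}$ and $q_{(01)^\infty}$ (probability measures on $\{0,1\}$). Let $c_0(1)=c_0(00)=1$ and, for $n\ge1$, $$c_n(1)=q_1(0)^n\prod_{k=0}^{n-1}q_{(01)^k1}(1),\qquad c_n(00)=q_1(0)^n\prod_{k=0}^{n-1}q_{(01)^k00}(1),$$ and let $S(1)=\sum_{n\ge0}c_n(1)$ and $S(00)=\sum_{n\ge0}c_n(00)\in[1,+\infty]$ (the series $S(1)$ always converges). (i) Assume that $q_1(0)\ne1$. Then the Markov process $(U_n)_{n\ge0}$ admits a stationary probability measure on $\mathcal L$, which is unique if and only if $S(1)-S(00)(1+q_1(0))\ne0$. (ii) Assume that $q_1(0)=1$. (ii.a) If $S(00)=\infty$, then $(U_n)_{n\ge0}$ admits $\pi=\frac12\delta_{(10)^\infty}+\frac12\delta_{(10)^\infty1}$ as unique stationary probability measure on $\mathcal L$. (ii.b) If $S(00)<\infty$, then $(U_n)_{n\ge0}$ admits a one-parameter family of stationary probability measures on $\mathcal L$.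
   Context: **Words.** $\mathcal A=\{0,1\}$; $\mathcal L=\mathcal A^{-\mathbb N}$ is the set of left-infinite sequences $\cdots\alpha_{-1}\alpha_0$. For $s=\cdots\alpha_{-1}\alpha_0\in\mathcal L$, $\overline s=\alpha_0\alpha_{-1}\cdots$ is the reversed, right-infinite sequence. For a finite word $w$, $\mathcal Lw$ is the set of $s\in\mathcal L$ having $w$ as a suffix; $\mathcal L$ carries the $\sigma$-algebra generated by these cylinders. As elements of $\mathcal L$, $(10)^\infty=\cdots101010$ (last letter $0$) and $(10)^\infty1=\cdots10101$ (last letter $1$). $\delta_s$ is the Dirac measure at $s$. **Bamboo blossom.** It is the saturated tree (every internal node $w$ has both children $w0$ and $w1$) whose internal nodes are the words $(01)^n$ and $(01)^n0$, $n\ge0$, and whose leaves (contexts) are the finite words $(01)^n1$ and $(01)^n00$, $n\ge0$, together with the right-infinite word $(01)^\infty=0101\cdots$. It is probabilized by a family of probability measures $q_c$ on $\mathcal A$ indexed by the contexts (for $n=0$ the finite contexts are $1$ and $00$). **VLMC.** For $s\in\mathcal L$, $\mathrm{pref}(s)$ is the unique context that is a prefix of $\overline s$ (or equals $\overline s$). The variable length Markov chain (VLMC) is the $\mathcal L$-valued Markov chain $(U_n)_{n\ge0}$ with transitions $\mathbf P(U_{n+1}=U_n\alpha\mid U_n)=q_{\mathrm{pref}(U_n)}(\alpha)$, $\alpha\in\mathcal A$; a stationary probability measure is an invariant probability measure on $\mathcal L$ of this chain.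
   Formalization: Part (ii) additionally assumes q_{(01)^∞}(1)=1, and the uniqueness equivalence in (i) additionally assumes q_1(0)≠0 or q_{00}(1)=0; in the excluded cases the printed claims are false. *)

(* Defs.v *)
From HB Require Import structures.
From mathcomp Require Import all_boot all_order all_algebra.
From mathcomp Require Import all_classical all_reals all_analysis.

Set Implicit Arguments.
Unset Strict Implicit.
Unset Printing Implicit Defensive.

Import Order.TTheory GRing.Theory Num.Theory.
Import numFieldNormedType.Exports.

Local Open Scope classical_set_scope.
Local Open Scope ring_scope.

(* The letters 0 and 1 are [false] and [true]. A left-infinite word
   s = ... α_{-1} α_0 is encoded by the function n |-> α_{-n}; read from index 0
   upwards, the same function is the reversed right-infinite word. *)
Definition rev_prefix (w : seq bool) (s : nat -> bool) : Prop :=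
  mkseq s (size w) = w.

(* The left-infinite words that have w as a suffix. *)
Definition cylinder (w : seq bool) : set (nat -> bool) :=
  [set s | rev_prefix (rev w) s].

Definition cylinders : set (set (nat -> bool)) := range cylinder.

Notation leftword := (g_sigma_algebraType cylinders).

Definition append (s : leftword) (a : bool) : leftword :=
  fun n => if n is m.+1 then s m else a.

(* (10)^∞ = ...1010 and (10)^∞1 = ...10101, indexed from their last letter. *)
Definition w10 : leftword := fun n => odd n.
Definition w10_1 : leftword := fun n => ~~ odd n.

(* [Leaf1 n], [Leaf00 n] and [LeafInf] are the leaves (01)^n 1, (01)^n 00 and
   (01)^∞ of the tree. *)
Inductive bamboo : Type := Leaf1 of nat | Leaf00 of nat | LeafInf.
HB.instance Definition _ := gen_eqMixin bamboo.
HB.instance Definition _ := gen_choiceMixin bamboo.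

Definition pow01 (n : nat) : seq bool := flatten (nseq n [:: false; true]).

Definition leaf_prefix (c : bamboo) (s : leftword) : Prop :=
  match c with
  | Leaf1 n => rev_prefix (pow01 n ++ [:: true]) s
  | Leaf00 n => rev_prefix (pow01 n ++ [:: false; false]) s
  | LeafInf => s = (fun n => odd n)
  end.

(* The default value of [xget] is never used, see [prefP] and [pref_unique]. *)
Definition pref (s : leftword) : bamboo := xget LeafInf [set c | leaf_prefix c s].

Lemma mkseqSl (s : nat -> bool) n :
  mkseq s n.+1 = s 0%N :: mkseq (fun i => s i.+1) n.
Proof. by rewrite /mkseq /= -[1%N]addn0 iotaDl -map_comp. Qed.

Lemma rev_prefix_pow01 n w (s : nat -> bool) :
  rev_prefix (pow01 n ++ w) s <->
  (forall i, (i < n.*2)%N -> s i = odd i) /\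
  rev_prefix w (fun i => s (n.*2 + i)%N).
Proof.
elim: n s => [|n IH] s; first by split=> // -[].
have -> : pow01 n.+1 ++ w = [:: false, true & pow01 n ++ w] by [].
rewrite /rev_prefix /= !mkseqSl; split.
  case=> s0 s1 /(IH (fun i => s i.+2))[h hw]; split; last first.
    by move: hw; rewrite /rev_prefix.
  by case=> [|[|i]] //; rewrite doubleS !ltnS => /h /= ->; rewrite negbK.
case=> h hw; rewrite (h 0%N)// (h 1%N)//; congr [:: _, _ & _].
apply/(IH (fun i => s i.+2)); split=> [i ilt|]; last exact: hw.
by rewrite h ?doubleS//= negbK.
Qed.

Lemma leaf_prefix_ex (s : leftword) : exists c, leaf_prefix c s.
Proof.
have [h|/existsNP ne] := pselect (forall n, s n = odd n).
  by exists LeafInf; apply/funext.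
have ex : exists n, s n != odd n by case: ne => n /eqP; exists n.
case: (ex_minnP ex) => m sm mmin.
have h i : (i < m)%N -> s i = odd i.
  by move=> im; apply/eqP; apply: contraTT im => /mmin; rewrite -leqNgt.
have := odd_double_half m; set k := m./2 => mE.
case om : (odd m) mE => /= mE.
  exists (Leaf00 k); apply/rev_prefix_pow01; split=> [i ilt|].
    by apply: h; rewrite -mE add1n ltnW.
  have sk : s k.*2 = false by rewrite h ?odd_double// -mE.
  have sk1 : s k.*2.+1 = false.
    by rewrite -add1n mE; move: sm; rewrite om; case: (s m).
  by rewrite /rev_prefix /mkseq /= addn0 addn1 sk sk1.
exists (Leaf1 k); apply/rev_prefix_pow01; split=> [i ilt|].
  by apply: h; rewrite -mE.
have sk : s k.*2 = true.
  by rewrite -[k.*2]add0n mE; move: sm; rewrite om; case: (s m).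
by rewrite /rev_prefix /mkseq /= addn0 sk.
Qed.

Lemma prefP (s : leftword) : leaf_prefix (pref s) s.
Proof.
exact: (@xgetPex _ LeafInf [set c | leaf_prefix c s] (leaf_prefix_ex s)).
Qed.

Lemma leaf_first_diff (c : bamboo) (s : leftword) : leaf_prefix c s ->
  match c with
  | Leaf1 n => (forall i, (i < n.*2)%N -> s i = odd i) /\ s n.*2 = true
  | Leaf00 n =>
      (forall i, (i < n.*2.+1)%N -> s i = odd i) /\ s n.*2.+1 = false
  | LeafInf => forall i, s i = odd i
  end.
Proof.
case: c => [n|n|] /=; last by move=> ->.
  move=> /rev_prefix_pow01[h]; rewrite /rev_prefix /= /mkseq /= addn0.
  by case.
move=> /rev_prefix_pow01[h]; rewrite /rev_prefix /= /mkseq /= addn0 addn1.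
case=> s0 s1; split=> // i; rewrite ltnS leq_eqVlt => /orP[/eqP ->|/h//].
by rewrite odd_double.
Qed.

Lemma leaf_prefix_unique (c c' : bamboo) (s : leftword) :
  leaf_prefix c s -> leaf_prefix c' s -> c = c'.
Proof.
pose d c := match c with Leaf1 n => Some n.*2 | Leaf00 n => Some n.*2.+1
  | LeafInf => None end.
have dP c1 : leaf_prefix c1 s -> match d c1 with
    | Some m => (forall i, (i < m)%N -> s i = odd i) /\ s m <> odd m
    | None => forall i, s i = odd i end.
  move=> /leaf_first_diff; case: c1 => [n|n|]//= [h e]; split=> //.
    by rewrite e odd_double.
  by rewrite e /= odd_double.
have dI : injective d.
  case=> [n|n|] [m|m|] //= [] /eqP.
  - by rewrite -!muln2 eqn_pmul2r// => /eqP ->.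
  - by move=> /eqP /(congr1 odd); rewrite /= !odd_double.
  - by move=> /eqP /(congr1 odd); rewrite /= !odd_double.
  - by rewrite -!muln2 eqn_pmul2r// => /eqP ->.
move=> /dP h /dP h'; apply: dI; case: (d c) (d c') h h' => [m|] [m'|] //.
- move=> [h1 h2] [h1' h2']; have [lt|lt|->//] := ltngtP m m'.
    by have := h1' _ lt.
  by have := h1 _ lt.
- by move=> [_ h2] h; have := h m.
- by move=> h [_ h2]; have := h m'.
Qed.

Lemma pref_unique (c : bamboo) (s : leftword) : leaf_prefix c s -> pref s = c.
Proof. by move=> hc; exact: leaf_prefix_unique (prefP s) hc. Qed.

Section vlmc.
Variable R : realType.
Local Open Scope ereal_scope.

Implicit Types (q : bamboo -> probability bool R)
  (mu nu : {measure set leftword -> \bar R}).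

Definition qval q (c : bamboo) (a : bool) : R := fine (q c [set a]).

Definition vlmc_transition q (s : leftword) (A : set leftword) : \bar R :=
  \sum_(a : bool) (q (pref s) [set a] * \d_(append s a) A).

Definition stationary_probability q mu : Prop :=
  mu setT = 1 /\
  forall A, measurable A -> mu A = \int[mu]_s vlmc_transition q s A.

(* Measures are functions on all subsets, so they are compared on measurable
   sets only. *)
Definition same_measure mu nu : Prop := forall A, measurable A -> mu A = nu A.

Definition cfun1 q (n : nat) : R :=
  (qval q (Leaf1 0) false ^+ n * \prod_(k < n) qval q (Leaf1 k) true)%R.

Definition cfun00 q (n : nat) : R :=
  (qval q (Leaf1 0) false ^+ n * \prod_(k < n) qval q (Leaf00 k) true)%R.

(* If q_1(0) = 0 then S1 = S00 = 1 whatever q_00 is, although q_00(1) <> 0 makes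
   the word ...111 the only stationary state. *)
Definition S1 q : \bar R := \sum_(0 <= n <oo) (cfun1 q n)%:E.
Definition S00 q : \bar R := \sum_(0 <= n <oo) (cfun00 q n)%:E.

(* Stationarity of this measure requires q_1(0) = 1 for the step from (10)^∞1 to
   (10)^∞, and q_{(01)^∞}(1) = 1 for the step from (10)^∞ to (10)^∞1. *)
Definition half_half : {measure set leftword -> \bar R} :=
  measure_add (mscale (2^-1 : R)%:nng%R \d_w10) (mscale (2^-1 : R)%:nng%R \d_w10_1).

(* F is, up to equality of measures, a continuous injective image of [0, 1]. *)
Definition one_parameter_family (F : set {measure set leftword -> \bar R}) :
    Prop :=
  exists p : R -> {measure set leftword -> \bar R},
    [/\ forall t, t \in `[0%R, 1%R] -> F (p t),
        forall t u, t \in `[0%R, 1%R] -> u \in `[0%R, 1%R] ->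
          same_measure (p t) (p u) -> t = u,
        forall A, measurable A ->
          {within `[0%R, 1%R], continuous (fun t => fine (p t A))}
      & forall mu, F mu ->
          exists2 t, t \in `[0%R, 1%R] & same_measure mu (p t)].

End vlmc.

(* Main.v *)
Require Import Defs.
From mathcomp Require Import all_boot all_order all_algebra.
From mathcomp Require Import all_classical all_reals all_analysis.
From mathcomp Require Import measurable_realfun measurable_fun_approximation.
From mathcomp Require Import ring lra.

Import Order.TTheory GRing.Theory Num.Theory.
Import numFieldNormedType.Exports.
Local Open Scope classical_set_scope.
Local Open Scope ring_scope.

(** Throughout, p stands for q_1(0), and x, y, z for the masses that a measure
gives to the words ending in 1, to the words ending in 00, and to the word
(10)^∞.

Restricted to the words of one context c, the chain appends the letter a with
the constant probability q_c(a).  Hence a probability measure is stationary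
iff appending a to a set of words of context c multiplies its mass by q_c(a)
([stationary_atP]).  The words of context (01)^(n+1) 1 are those of context
(01)^n 1 followed by 1 and then by 0, so the masses of these contexts are
c_n(1) x ([mass1]); likewise those of the contexts (01)^n 00 are c_n(00) y
([mass00]).  Adding up all masses by last letters and by contexts gives
<<
  y + (1 + p) x = 1        and        S(1) x + S(00) y + z = 1,
>>
while z = p q_(01)^∞(1) z ([mass_letters], [mass_contexts], [mass_inf]).  The
masses of the contexts in turn determine the measure ([same_masses]): a
cylinder and a context are nested or disjoint, so the mass of a cylinder is
computed letter by letter.  Eliminating y leaves
<<
  (S(1) - S(00) (1 + p)) x = 1 - S(00) - z,
>>
and since S(1) <= 1 + p <= S(00) (1 + p), the determinant is never positive,
and it vanishes only if S(00) = 1 and S(1) = 1 + p.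

It remains to realize every nonnegative solution (x, y) with z = 0 by a
stationary measure ([stationary_existence]).  The chain forgets everything
before the last repeated letter of a word, so it is driven by a countable set
of states.  The equations for x and y say that some law on these states is
invariant; this is a telescoping sum along the sequences of words s, s10,
s1010, ... ([ladder_step]).  Starting from this law, let m(w) be the
probability that the chain appends the letters of w.  By invariance, m(w) =
m(0w) + m(1w), and such a function is the restriction to cylinders of a
probability measure on left-infinite words, the image of Lebesgue measure
under a quantile map ([cylinder_extension]).  That measure is stationary.

If p < 1 then z = 0, and everything depends on the determinant alone: if it is
not zero then x is determined, and if it is zero then x = 1 / (1 + p), y = 0
and x = 0, y = 1 are two solutions ([unique_iff]).  If p = 1 then S(1) = 1;
an infinite S(00) forces y = 0, hence x = z = 1/2, whereas for a finite S(00)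
the number z determines the measure, and the stationary measures are the
mixtures of the measure with z = 1/2 and of the one with z = 0. *)

(** * Words, cylinders and contexts *)

Definition chop (s : leftword) : leftword := fun n => s n.+1.

Lemma append_chop s : append (chop s) (s 0%N) = s.
Proof. by apply/funext; case. Qed.

Lemma cylinder_nil : cylinder [::] = setT.
Proof. by apply/seteqP; split. Qed.

Lemma cylinder_rcons w a (s : leftword) :
  cylinder (rcons w a) s <-> s 0%N = a /\ cylinder w (chop s).
Proof.
rewrite /cylinder /= rev_rcons /rev_prefix /= mkseqSl; split; first by case.
by case=> -> ->.
Qed.

Lemma cylinder_cons b w (s : leftword) :
  cylinder (b :: w) s <-> cylinder w s /\ s (size w) = b.
Proof.
rewrite /cylinder /= rev_cons /rev_prefix size_rcons mkseqS size_rev.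
split=> [/rcons_inj[-> ->]//|[-> ->]//].
Qed.

Lemma measurable_cylinder w : measurable (cylinder w : set leftword).
Proof. by apply: sub_sigma_algebra; exists w. Qed.
#[local] Hint Resolve measurable_cylinder : core.

(** Two suffix conditions are comparable or contradictory, according to whether
the shorter word is a suffix of the longer one.  Up to the empty set, the
cylinders are therefore stable under intersection. *)
Lemma cylinder_laminar w w' :
  [\/ cylinder w `&` cylinder w' = set0, cylinder w `<=` cylinder w' |
      cylinder w' `<=` cylinder w].
Proof.
wlog le_ww' : w w' / (size w <= size w')%N.
  move=> H; have [/H//|/ltnW/H] := leqP (size w) (size w').
  by rewrite setIC => -[]; [constructor 1|constructor 3|constructor 2].
(* Reversal turns suffixes into prefixes, which [take] compares. *)
have takeE s : cylinder w' s -> mkseq s (size w) = take (size w) (rev w').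
  rewrite /cylinder /= /rev_prefix size_rev => <-.
  by rewrite /mkseq -map_take take_iota (minn_idPl le_ww').
have [e|ne] := eqVneq (take (size w) (rev w')) (rev w).
  constructor 3 => s /takeE; rewrite e /cylinder /= /rev_prefix size_rev.
  exact.
constructor 1; apply/seteqP; split=> // s [].
rewrite {1}/cylinder /= /rev_prefix size_rev => e /takeE; rewrite e => e'.
by move: ne; rewrite e' eqxx.
Qed.

Lemma cylinder_measure_unique (R : realType)
    (m1 m2 : {measure set leftword -> \bar R}) :
  (m1 setT < +oo)%E -> (forall w, m1 (cylinder w) = m2 (cylinder w)) ->
  same_measure m1 m2.
Proof.
move=> m1oo m12; pose G : set (set leftword) := cylinders `|` [set set0].
have GE : @measurable _ leftword = <<s G >>.
  apply/seteqP; split; last first.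
    apply: smallest_sub; first exact: smallest_sigma_algebra.
    by move=> _ [[w _ <-]|->]; [exact: measurable_cylinder|exact: measurable0].
  apply: smallest_sub; first exact: smallest_sigma_algebra.
  by move=> _ [w _ <-]; apply: sub_sigma_algebra; left; exists w.
apply: (@measure_unique _ _ _ G (fun=> setT)) => //.
- move=> _ _ [[w _ <-]|->] [[w' _ <-]|->]; rewrite ?setI0 ?set0I; try by right.
  have [->|/setIidPl ->|/setIidPr ->] := cylinder_laminar w w'.
  + by right.
  + by left; exists w.
  + by left; exists w'.
- by move=> _; left; exists [::] => //; exact: cylinder_nil.
- by rewrite bigcup_const.
- by move=> _ [[w _ <-]|->]; [exact: m12|rewrite !measure0].
Qed.

Lemma chop_preimage_cylinder w : chop @^-1` cylinder w =
  cylinder (rcons w false) `|` cylinder (rcons w true).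
Proof.
apply/seteqP; split=> s /=; last by move=> [|] /cylinder_rcons[].
move=> ws; case e : (s 0%N); [right|left]; exact/cylinder_rcons.
Qed.

Lemma measurable_chop : measurable_fun setT chop.
Proof.
apply: (@measurability _ _ leftword leftword setT chop cylinders) => //.
move=> _ [_ [w _ <-] <-]; rewrite setTI.
rewrite chop_preimage_cylinder; exact: measurableU.
Qed.

Lemma measurable_append a : measurable_fun setT (append^~ a).
Proof.
apply: (@measurability _ _ leftword leftword setT (append^~ a) cylinders) => //.
move=> _ [_ [w _ <-] <-]; rewrite setTI; elim/last_ind: w => [|w b _].
  by rewrite cylinder_nil preimage_setT.
have [<-|ab] := eqVneq a b.
  suff -> : append^~ a @^-1` cylinder (rcons w a) = cylinder w by [].
  by apply/seteqP; split=> s; rewrite /preimage /=;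
    [case/cylinder_rcons|move=> ws; apply/cylinder_rcons].
suff -> : append^~ a @^-1` cylinder (rcons w b) = set0 by [].
by apply/seteqP; split=> // s /cylinder_rcons[] /= e; rewrite e eqxx in ab.
Qed.

Definition ext (a : bool) (B : set leftword) : set leftword :=
  [set s | s 0%N = a /\ B (chop s)].

Lemma ext_append a b B s : ext a B (append s b) <-> b = a /\ B s.
Proof. by []. Qed.

Lemma cylinder_ext w a : cylinder (rcons w a) = ext a (cylinder w).
Proof. by apply/seteqP; split=> s /cylinder_rcons. Qed.

Lemma measurable_ext a B : measurable B -> measurable (ext a B).
Proof.
move=> mB; have -> : ext a B = cylinder [:: a] `&` chop @^-1` B.
  by apply/seteqP; split=> s [h Bs]; split => //;
    [apply/(cylinder_rcons [::])|case/(cylinder_rcons [::]): h].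
apply: measurableI => //; rewrite -[X in measurable X]setTI.
exact: measurable_chop.
Qed.
#[local] Hint Resolve measurable_ext : core.

Definition ctx (c : bamboo) : set leftword := [set s | leaf_prefix c s].

Lemma ctxP c s : ctx c s <-> pref s = c.
Proof.
split=> [|<-]; [exact: pref_unique|exact: prefP].
Qed.

(** The infinite context has no word: it is a single point, not a cylinder. *)
Definition ctx_word (c : bamboo) : seq bool :=
  match c with
  | Leaf1 n => rev (pow01 n ++ [:: true])
  | Leaf00 n => rev (pow01 n ++ [:: false; false])
  | LeafInf => [::]
  end.

Lemma ctx_cylinder c : c <> LeafInf -> ctx c = cylinder (ctx_word c).
Proof. by case: c => // n _; rewrite /ctx /= /cylinder revK. Qed.

Lemma measurable_ctx c : measurable (ctx c).
Proof.
case: c => [n|n|]; try by rewrite ctx_cylinder.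
have -> : ctx LeafInf = \bigcap_n cylinder (rev (mkseq (fun n => odd n) n)).
  apply/seteqP; split=> s.
    by move=> -> n _; rewrite /cylinder /= revK /rev_prefix size_mkseq.
  move=> h; apply/funext => n.
  have := h n.+1 Logic.I; rewrite /cylinder /= revK /rev_prefix size_mkseq.
  by rewrite !mkseqS => /rcons_inj[].
exact: bigcapT_measurable.
Qed.
#[local] Hint Resolve measurable_ctx : core.

Lemma ctx1S n (s : leftword) :
  ctx (Leaf1 n.+1) s <->
  [/\ s 0%N = false, s 1%N = true & ctx (Leaf1 n) (chop (chop s))].
Proof.
rewrite /ctx /= /rev_prefix /= !mkseqSl.
by split=> [[-> -> h]|[-> -> h]]; [split=> //; exact: h|rewrite -[in RHS]h].
Qed.

Lemma ctx00S n (s : leftword) :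
  ctx (Leaf00 n.+1) s <->
  [/\ s 0%N = false, s 1%N = true & ctx (Leaf00 n) (chop (chop s))].
Proof.
rewrite /ctx /= /rev_prefix /= !mkseqSl.
by split=> [[-> -> h]|[-> -> h]]; [split=> //; exact: h|rewrite -[in RHS]h].
Qed.

Lemma ctx1_0 (s : leftword) : ctx (Leaf1 0) s <-> s 0%N = true.
Proof. by rewrite /ctx /= /rev_prefix /= /mkseq /=; split=> [[]|->]. Qed.

Lemma ctx00_0 (s : leftword) :
  ctx (Leaf00 0) s <-> s 0%N = false /\ s 1%N = false.
Proof.
by rewrite /ctx /= /rev_prefix /= /mkseq /=; split=> [[-> ->]|[-> ->]].
Qed.

(** Countable additivity over the contexts is used through this enumeration by
natural numbers. *)
Definition ctx_enum (n : nat) : bamboo :=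
  if n is m.+1 then (if odd m then Leaf00 m./2 else Leaf1 m./2) else LeafInf.

Lemma ctx_enum_surj c : exists n, ctx_enum n = c.
Proof.
case: c => [n|n|]; last by exists 0%N.
- by exists n.*2.+1; rewrite /= odd_double doubleK.
- by exists n.*2.+2; rewrite /= odd_double uphalf_double.
Qed.

Lemma ctx_enum_inj : injective ctx_enum.
Proof.
move=> [|m] [|n] //=; try by case: odd.
case om : (odd m); case on : (odd n) => // -[mn];
  by rewrite -[m]odd_double_half -[n]odd_double_half om on mn.
Qed.

Lemma trivIset_ctx (I : Type) (f : I -> bamboo) : injective f ->
  trivIset setT (ctx \o f).
Proof.
by move=> fI i j _ _ [s [/= /ctxP ei /ctxP ej]]; apply: fI; rewrite -ei -ej.
Qed.

Lemma bigcup_ctx : \bigcup_n ctx (ctx_enum n) = setT.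
Proof.
apply/seteqP; split=> // s _; have [n nE] := ctx_enum_surj (pref s).
by exists n => //; apply/ctxP.
Qed.

(** * Stationarity, context by context *)

Section stationarity.
Local Open Scope ereal_scope.
Context {R : realType} (q : bamboo -> probability bool R).
Implicit Types (mu nu : {measure set leftword -> \bar R}).

Lemma qvalE c a : q c [set a] = (qval q c a)%:E.
Proof. by rewrite /qval fineK// fin_num_measure. Qed.

Lemma qval_ge0 c a : (0 <= qval q c a)%R.
Proof. by rewrite -lee_fin -qvalE. Qed.

Lemma qval_sum c : (qval q c false + qval q c true = 1)%R.
Proof.
apply: EFin_inj; rewrite EFinD -!qvalE -measureU//.
- have -> : [set false] `|` [set true] = setT.
    by apply/seteqP; split=> // -[] _; [right|left].
  exact: probability_setT.
- by apply/seteqP; split=> // -[] [].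
Qed.

Lemma qval_false c : qval q c false = (1 - qval q c true)%R.
Proof. by rewrite -(qval_sum c) addrK. Qed.

Lemma qval_true c : qval q c true = (1 - qval q c false)%R.
Proof. by rewrite -(qval_sum c) addrC addKr. Qed.

Lemma qval_le1 c a : (qval q c a <= 1)%R.
Proof.
have := qval_ge0 c (~~ a); have := qval_sum c.
by case: a => /=; move: (qval _ _ _) (qval _ _ _) => u v; lra.
Qed.

Lemma vlmc_transitionE s A : vlmc_transition q s A =
  (qval q (pref s) true)%:E * (\1_A (append s true))%:E +
  (qval q (pref s) false)%:E * (\1_A (append s false))%:E.
Proof. by rewrite /vlmc_transition big_bool /= !qvalE /= !diracE. Qed.

(** The context takes countably many values, each on a measurable set. *)
Lemma measurable_fun_pref (g : bamboo -> \bar R) :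
  measurable_fun setT (fun s : leftword => g (pref s)).
Proof.
move=> _ Y _; rewrite setTI.
have -> : (fun s : leftword => g (pref s)) @^-1` Y =
    \bigcup_n (if `[< Y (g (ctx_enum n)) >] then ctx (ctx_enum n) else set0).
  apply/seteqP; split=> s /=.
    move=> Ys; have [n nE] := ctx_enum_surj (pref s).
    by exists n => //; rewrite nE asboolT//; exact/ctxP.
  by move=> [n _]; case: asboolP => // h /ctxP ->.
by apply: bigcupT_measurable => n; case: ifP.
Qed.

Lemma measurable_append_indic a A : measurable A ->
  measurable_fun setT (fun s => (\1_A (append s a))%:E : \bar R).
Proof.
move=> mA; apply/measurable_EFinP.
apply: (measurableT_comp (f := \1_A : leftword -> R) _ (measurable_append a)).
exact: measurable_indic.
Qed.

Lemma measurable_vlmc_transition A : measurable A ->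
  measurable_fun setT (fun s => vlmc_transition q s A).
Proof.
move=> mA; rewrite (_ : (fun s => _) = fun s =>
  (qval q (pref s) true)%:E * (\1_A (append s true))%:E +
  (qval q (pref s) false)%:E * (\1_A (append s false))%:E); last first.
  by apply/funext => s; exact: vlmc_transitionE.
by apply: emeasurable_funD; apply: emeasurable_funM;
  [exact: (measurable_fun_pref (fun c => (qval q c true)%:E))
  |exact: measurable_append_indic
  |exact: (measurable_fun_pref (fun c => (qval q c false)%:E))
  |exact: measurable_append_indic].
Qed.

Lemma vlmc_transition_ge0 s A : 0 <= vlmc_transition q s A.
Proof.
by rewrite vlmc_transitionE adde_ge0// mule_ge0// lee_fin// qval_ge0.
Qed.

(** On a single context the transition probabilities are constant, which turns
the integral equation into a product. *)
Definition stationary_at mu (c : bamboo) : Prop :=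
  forall a B, measurable B -> B `<=` ctx c ->
    mu (ext a B) = (qval q c a)%:E * mu B.

Lemma measure_partition mu (F : (set leftword)^nat) A :
  (forall n, measurable (F n)) -> trivIset setT F -> \bigcup_n F n = setT ->
  measurable A -> mu A = \sum_(0 <= n <oo) mu (A `&` F n).
Proof.
move=> mF tF UF mA; rewrite -[in LHS](setIT A) -UF setI_bigcupr.
rewrite measure_semi_bigcup//.
- by move=> n; exact: measurableI.
- by apply: trivIset_setIl.
- by apply: bigcupT_measurable => n; exact: measurableI.
Qed.

(** One implication is the stationarity equation for the set [ext a B].  For the
converse, a set is cut into pieces according to the last letter of its words
and to the context of what comes before; each piece is an [ext a B], and the
masses of the pieces add up to the integral of the transition probabilities
over the contexts. *)
Lemma stationary_atP mu : stationary_probability q mu <->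
  mu setT = 1 /\ forall c, stationary_at mu c.
Proof.
split=> [[mu1 st]|[mu1 st]]; split=> //;
  [move=> c a B mB Bc|move=> A mA].
  rewrite st; last exact: measurable_ext.
  transitivity (\int[mu]_s ((qval q c a)%:E * (\1_B s)%:E)); last first.
    rewrite ge0_integralZl//; last by rewrite lee_fin qval_ge0.
      by rewrite integral_indic// setIT.
    by apply/measurable_EFinP; exact: measurable_indic.
  apply: eq_integral => s _; rewrite vlmc_transitionE.
  have eE b : (\1_(ext a B) (append s b) : R) = ((b == a)%:R * \1_B s)%R.
    rewrite !indicE -natrM mulnb; congr ((nat_of_bool _)%:R); apply/idP/idP.
      by move=> /set_mem/ext_append[-> Bs]; rewrite eqxx mem_set.
    by case/andP=> /eqP -> /set_mem Bs; apply/mem_set.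
  rewrite !eE; have [Bs|Bs] := pselect (B s); last first.
    by rewrite (indicE _ B) memNset// !mulr0 !mule0 adde0.
  rewrite (_ : pref s = c); last by apply/ctxP; exact: Bc.
  by case: a {eE}; rewrite /= mul0r mul1r mule0 ?add0e ?adde0.
have mT : measurable_fun (\bigcup_n ctx (ctx_enum n))
    (fun s => vlmc_transition q s A).
  by rewrite bigcup_ctx; exact: measurable_vlmc_transition.
have tC : trivIset setT (fun n => ctx (ctx_enum n)).
  exact: (trivIset_ctx _ _ ctx_enum_inj).
rewrite -bigcup_ctx ge0_integral_bigcup//; last first.
  by move=> s _; exact: vlmc_transition_ge0.
rewrite (measure_partition mu
  (fun n => chop @^-1` ctx (ctx_enum n)) A)//; last 3 first.
- move=> n; rewrite -[X in measurable X]setTI.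
  exact: measurable_chop.
- by move=> i j _ _ [s [si sj]]; apply: tC => //; exists (chop s).
- by rewrite -preimage_bigcup bigcup_ctx.
apply: eq_eseriesr => n _; set c := ctx_enum n.
have mAa a : measurable (append^~ a @^-1` A `&` ctx c).
  apply: measurableI => //; rewrite -[X in measurable X]setTI.
  exact: measurable_append.
have -> : A `&` chop @^-1` ctx c =
    ext true (append^~ true @^-1` A `&` ctx c) `|`
    ext false (append^~ false @^-1` A `&` ctx c).
  apply/seteqP; split=> s /=.
    case=> As cs; rewrite -(append_chop s) in As.
    by case e : (s 0%N) As => As; [left|right]; split.
  by case=> -[e [As cs]]; split=> //; rewrite -(append_chop s) e.
have -> : mu (ext true (append^~ true @^-1` A `&` ctx c) `|`
    ext false (append^~ false @^-1` A `&` ctx c)) =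
    mu (ext true (append^~ true @^-1` A `&` ctx c)) +
    mu (ext false (append^~ false @^-1` A `&` ctx c)).
  apply: measureU => //; try exact: measurable_ext.
  by apply/seteqP; split=> // s [[e _] [/=]]; rewrite e.
rewrite !(st c)//; try by move=> ? [].
under eq_integral => s /set_mem/ctxP sc do rewrite vlmc_transitionE sc.
have mI a : measurable_fun (ctx c) (fun s => (\1_A (append s a))%:E : \bar R).
  by apply: measurable_funTS; exact: measurable_append_indic.
have I a : \int[mu]_(s in ctx c) ((qval q c a)%:E * (\1_A (append s a))%:E) =
    (qval q c a)%:E * mu (append^~ a @^-1` A `&` ctx c).
  rewrite ge0_integralZl//; last by rewrite lee_fin qval_ge0.
  rewrite -integral_indic//.
  by rewrite -[X in measurable X]setTI; exact: measurable_append.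
rewrite ge0_integralD//.
- by rewrite !I.
- by move=> s _; rewrite mule_ge0// lee_fin// qval_ge0.
- by apply: emeasurable_funM.
- by move=> s _; rewrite mule_ge0// lee_fin// qval_ge0.
- by apply: emeasurable_funM.
Qed.

End stationarity.

(** * Masses of the contexts of a stationary measure *)

Section masses.
Local Open Scope ereal_scope.
Context {R : realType} (q : bamboo -> probability bool R).
Local Notation p := (qval q (Leaf1 0) false).

Lemma cfun1S n :
  (cfun1 q n.+1 = p * (qval q (Leaf1 n) true * cfun1 q n))%R.
Proof. by rewrite /cfun1 exprS big_ord_recr /=; ring. Qed.

Lemma cfun00S n :
  (cfun00 q n.+1 = p * (qval q (Leaf00 n) true * cfun00 q n))%R.
Proof. by rewrite /cfun00 exprS big_ord_recr /=; ring. Qed.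

Lemma cfun1_0 : cfun1 q 0 = 1%R.
Proof. by rewrite /cfun1 big_ord0 mulr1. Qed.

Lemma cfun00_0 : cfun00 q 0 = 1%R.
Proof. by rewrite /cfun00 big_ord0 mulr1. Qed.

Lemma cfun1_ge0 n : (0 <= cfun1 q n)%R.
Proof.
by rewrite mulr_ge0 ?exprn_ge0 ?qval_ge0// prodr_ge0// => k _; rewrite qval_ge0.
Qed.

Lemma cfun00_ge0 n : (0 <= cfun00 q n)%R.
Proof.
by rewrite mulr_ge0 ?exprn_ge0 ?qval_ge0// prodr_ge0// => k _; rewrite qval_ge0.
Qed.

Lemma ctx1_ext n : ctx (Leaf1 n.+1) = ext false (ext true (ctx (Leaf1 n))).
Proof. by apply/seteqP; split=> s; [case/ctx1S|case=> ? []; rewrite ctx1S]. Qed.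

Lemma ctx00_ext n : ctx (Leaf00 n.+1) = ext false (ext true (ctx (Leaf00 n))).
Proof. by apply/seteqP; split=> s; [case/ctx00S|case=> ? []; rewrite ctx00S]. Qed.

Lemma ext_true_ctx B : ext true B `<=` ctx (Leaf1 0).
Proof. by move=> s [s0 _]; apply/ctx1_0. Qed.

Variable mu : {measure set leftword -> \bar R}.

(** A word that ends in 1 has context 1, so the letter 0 follows with
probability p whatever comes before. *)
Lemma mass_ext_10 c B : stationary_at q mu (Leaf1 0) -> stationary_at q mu c ->
  measurable B -> B `<=` ctx c ->
  mu (ext false (ext true B)) = (p * qval q c true)%:E * mu B.
Proof.
move=> st1 stc mB Bc; rewrite (st1 false _ (measurable_ext true _ mB) (ext_true_ctx B)).
by rewrite stc// muleA -EFinM.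
Qed.

(** Appending 1 and then 0 to (10)^∞ gives (10)^∞ back, and no other word leads
there in two steps. *)
Lemma mass_inf : stationary_at q mu (Leaf1 0) -> stationary_at q mu LeafInf ->
  mu [set w10] = (p * qval q LeafInf true)%:E * mu [set w10].
Proof.
move=> st1 sti; rewrite -mass_ext_10//; last exact: (measurable_ctx LeafInf).
congr (mu _); apply/seteqP; split=> s.
  by move=> ->; do !split=> //; apply/funext => n; rewrite /chop /w10 /= negbK.
case=> s0 [s1 /= s2]; apply/funext => -[//|[//|n]].
by rewrite -[LHS]/(chop (chop s) n) s2 /w10 /= negbK.
Qed.

(** The infinite context is left out: for the measure constructed below, the
mass of (10)^∞ is found from the equations of this section before
stationarity at that context is known. *)
Hypothesis st : forall c, c <> LeafInf -> stationary_at q mu c.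

Lemma mass1 n : mu (ctx (Leaf1 n)) = mu (ctx (Leaf1 0)) * (cfun1 q n)%:E.
Proof.
elim: n => [|n IH]; first by rewrite cfun1_0 mule1.
rewrite ctx1_ext (mass_ext_10 (Leaf1 n))//; try exact: st.
by rewrite IH cfun1S muleCA -EFinM mulrA.
Qed.

Lemma mass00 n : mu (ctx (Leaf00 n)) = mu (ctx (Leaf00 0)) * (cfun00 q n)%:E.
Proof.
elim: n => [|n IH]; first by rewrite cfun00_0 mule1.
rewrite ctx00_ext (mass_ext_10 (Leaf00 n))//; try exact: st.
by rewrite IH cfun00S muleCA -EFinM mulrA.
Qed.

Hypothesis mu1 : mu setT = 1.

Lemma fin_mass A : measurable A -> mu A \is a fin_num.
Proof. by apply: lty_fin_num_fun; rewrite mu1 ltry. Qed.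

(** A word ends in 00, in 1 or in 10. *)
Lemma mass_letters :
  1 = mu (ctx (Leaf00 0)) + mu (ctx (Leaf1 0)) * (1 + p)%:E.
Proof.
rewrite -mu1; have -> : setT = ctx (Leaf00 0) `|`
    (ctx (Leaf1 0) `|` ext false (ctx (Leaf1 0))).
  apply/seteqP; split=> // s _.
  case e0 : (s 0%N); first by right; left; apply/ctx1_0.
  case e1 : (s 1%N); last by left; apply/ctx00_0.
  by right; right; split=> //; apply/ctx1_0.
transitivity (mu (ctx (Leaf00 0)) +
    mu (ctx (Leaf1 0) `|` ext false (ctx (Leaf1 0)))).
  apply: measureU => //; first by apply: measurableU => //; exact: measurable_ext.
  apply/seteqP; split=> // s [/ctx00_0[s0 s1]] [/ctx1_0|[_ /ctx1_0]].
    by rewrite s0.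
  by rewrite /chop s1.
congr (_ + _).
transitivity (mu (ctx (Leaf1 0)) + mu (ext false (ctx (Leaf1 0)))).
  apply: measureU => //; first exact: measurable_ext.
  by apply/seteqP; split=> // s [/ctx1_0 s0 []]; rewrite s0.
rewrite (st (Leaf1 0))// EFinD ge0_muleDr ?lee_fin ?qval_ge0//.
by rewrite mule1 [in RHS]muleC.
Qed.

Lemma mass_contexts : 1 =
  mu (ctx (Leaf1 0)) * S1 q + mu (ctx (Leaf00 0)) * S00 q + mu [set w10].
Proof.
rewrite -mu1; have -> : setT = (\bigcup_n ctx (Leaf1 n) `|` \bigcup_n ctx (Leaf00 n)) `|`
    [set w10].
  apply/seteqP; split=> // s _; have := prefP s; case: (pref s) => [n|n|] h.
  - by left; left; exists n.
  - by left; right; exists n.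
  - by right.
have m1 : measurable (\bigcup_n ctx (Leaf1 n)) by exact: bigcupT_measurable.
have m2 : measurable (\bigcup_n ctx (Leaf00 n)) by exact: bigcupT_measurable.
transitivity (mu (\bigcup_n ctx (Leaf1 n) `|` \bigcup_n ctx (Leaf00 n)) +
    mu [set w10]).
  apply: measureU => //; [exact: measurableU|exact: (measurable_ctx LeafInf)|].
  apply/seteqP; split=> // s [] [] [n _ /ctxP h] /(ctxP LeafInf);
    by rewrite h.
congr (_ + _).
transitivity (mu (\bigcup_n ctx (Leaf1 n)) + mu (\bigcup_n ctx (Leaf00 n))).
  apply: measureU => //.
  by apply/seteqP; split=> // s [] [n _ /ctxP h] [m _ /ctxP]; rewrite h.
congr (_ + _).
  rewrite measure_semi_bigcup//; last first.
    by apply: (trivIset_ctx _ (fun n => Leaf1 n)) => i j [].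
  rewrite -[mu (ctx (Leaf1 0))]fineK ?fin_mass//.
  rewrite /S1 -nneseriesZl//; last by move=> n _; rewrite lee_fin cfun1_ge0.
  by apply: eq_eseriesr => n _; rewrite fineK ?fin_mass//; exact: mass1.
rewrite measure_semi_bigcup//; last first.
  by apply: (trivIset_ctx _ (fun n => Leaf00 n)) => i j [].
rewrite -[mu (ctx (Leaf00 0))]fineK ?fin_mass//.
  rewrite /S00 -nneseriesZl//; last by move=> n _; rewrite lee_fin cfun00_ge0.
by apply: eq_eseriesr => n _; rewrite fineK ?fin_mass//; exact: mass00.
Qed.

End masses.

(** * The masses of the contexts determine a stationary measure *)

Section uniqueness.
Local Open Scope ereal_scope.
Context {R : realType} (q : bamboo -> probability bool R).
Implicit Types (mu nu : {measure set leftword -> \bar R}).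

Lemma cylinder_ctx w c : c <> LeafInf ->
  cylinder w `&` ctx c = set0 \/
  exists2 w', cylinder w `&` ctx c = cylinder w' & cylinder w' `<=` ctx c.
Proof.
move=> /ctx_cylinder ->; have [->|h|h] := cylinder_laminar w (ctx_word c).
- by left.
- by right; exists w => //; exact/setIidPl.
- by right; exists (ctx_word c) => //; exact/setIidPr.
Qed.

(** By induction on the length of the cylinder.  The mass of the words ending in
wa is a sum, over the contexts c, of q_c(a) times the mass of the words that end
in w and have context c; these words form the empty set, the cylinder of w, or
all of the context, so the two measures agree on them. *)
Lemma same_on_contexts mu nu :
  stationary_probability q mu -> stationary_probability q nu ->
  (forall c, mu (ctx c) = nu (ctx c)) -> same_measure mu nu.
Proof.
move=> /stationary_atP[mu1 stm] /stationary_atP[nu1 stn] mn.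
apply: cylinder_measure_unique => [|w]; first by rewrite mu1 ltry.
elim/last_ind: w => [|w a IH]; first by rewrite cylinder_nil mu1 nu1.
have P (m : {measure set leftword -> \bar R}) :
    (forall c, stationary_at q m c) -> m (cylinder (rcons w a)) =
    \sum_(0 <= n <oo) (qval q (ctx_enum n) a)%:E *
      m (cylinder w `&` ctx (ctx_enum n)).
  move=> stm'; rewrite (measure_partition m
    (fun n => chop @^-1` ctx (ctx_enum n)))//; last 3 first.
  - move=> n; rewrite -[X in measurable X]setTI; exact: measurable_chop.
  - move=> i j _ _ [s [/= /ctxP si /ctxP sj]]; apply: ctx_enum_inj.
    by rewrite -si -sj.
  - by rewrite -preimage_bigcup bigcup_ctx.
  apply: eq_eseriesr => n _.
  have mI : measurable (cylinder w `&` ctx (ctx_enum n) : set leftword).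
    exact: measurableI.
  rewrite -(stm' _ a _ mI (@subIsetr _ _ _)).
  congr (m _); rewrite cylinder_ext.
  by apply/seteqP; split=> s; [case=> -[s0 ws] cs|case=> s0 [ws cs]]; do !split.
rewrite !P//; apply: eq_eseriesr => n _; congr (_ * _).
have [->|cinf] := pselect (ctx_enum n = LeafInf).
  have [h|h] := pselect (cylinder w w10).
    suff -> : cylinder w `&` ctx LeafInf = ctx LeafInf by [].
    by apply/setIidPr => _ ->.
  suff -> : cylinder w `&` ctx LeafInf = set0 by rewrite !measure0.
  by apply/seteqP; split=> // s [ws sE]; case: h; rewrite (_ : w10 = s).
rewrite ctx_cylinder//.
have [->|/setIidPl ->//|/setIidPr ->] := cylinder_laminar w (ctx_word (ctx_enum n)).
  by rewrite !measure0.
by rewrite -ctx_cylinder.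
Qed.

(** The mass y follows from x by [mass_letters]. *)
Lemma same_masses mu nu :
  stationary_probability q mu -> stationary_probability q nu ->
  mu (ctx (Leaf1 0)) = nu (ctx (Leaf1 0)) -> mu [set w10] = nu [set w10] ->
  same_measure mu nu.
Proof.
move=> stm stn e1 einf; have /stationary_atP[mu1 stm'] := stm.
have /stationary_atP[nu1 stn'] := stn.
have e00 : mu (ctx (Leaf00 0)) = nu (ctx (Leaf00 0)).
  have := mass_letters q mu (fun c _ => stm' c) mu1; rewrite e1.
  have := mass_letters q nu (fun c _ => stn' c) nu1 => ->.
  have fx : nu (ctx (Leaf1 0)) * (1 + qval q (Leaf1 0) false)%:E \is a fin_num.
    by rewrite fin_numM// (fin_mass nu).
  by move=> /(congr1 (fun x => x - nu (ctx (Leaf1 0)) *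
    (1 + qval q (Leaf1 0) false)%:E)); rewrite !addeK => // ->.
apply: same_on_contexts => // -[n|n|//].
- by rewrite (mass1 q mu)// (mass1 q nu)// e1.
- by rewrite (mass00 q mu)// (mass00 q nu)// e00.
Qed.

End uniqueness.

(** * Measures with prescribed masses of cylinders *)

Lemma image_measure {R : realType} {d d'} {T : measurableType d}
    {T' : measurableType d'} (mu : {measure set T -> \bar R}) (f : T -> T') :
  measurable_fun setT f ->
  exists nu : {measure set T' -> \bar R}, forall A, nu A = mu (f @^-1` A).
Proof.
move=> mf; unshelve eexists.
  by refine (pushforward mu f : {measure set T' -> \bar R}).
by [].
Qed.

Section extension.
Local Open Scope ereal_scope.
(** Here m w is the mass intended for the words ending in w.  Prolonging w into
the past by one letter cuts an interval of length m w into two intervals, of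
lengths m (0w) and m (1w), starting from the unit interval. *)
Context {R : realType} (m : seq bool -> R).
Hypothesis m_ge0 : forall w, (0 <= m w)%R.
Hypothesis m_nil : m [::] = 1%R.
Hypothesis m_cons : forall w, (m w = m (false :: w) + m (true :: w))%R.

(** The left end of the interval of w. *)
Fixpoint lower (w : seq bool) : R :=
  if w is b :: w' then (lower w' + (if b then m (false :: w') else 0))%R else 0%R.

(** The word of length n whose interval contains t, for t in the unit
interval. *)
Fixpoint digits (t : R) (n : nat) : seq bool :=
  if n is n'.+1 then let d := digits t n' in
    (lower d + m (false :: d) <= t)%R :: d
  else [::].

Definition quantile (t : R) : leftword :=
  fun n => (lower (digits t n) + m (false :: digits t n) <= t)%R.

Lemma quantile_cylinder t w : cylinder w (quantile t) <-> digits t (size w) = w.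
Proof.
elim: w => [|b w IH]; first by split=> // _; rewrite cylinder_nil.
rewrite cylinder_cons IH /quantile /=; split=> [[wE]|[bE wE]].
  by rewrite wE => ->.
by rewrite wE; split=> //; rewrite -bE wE.
Qed.

Lemma quantile_preimage_cons b w : quantile @^-1` cylinder (b :: w) =
  quantile @^-1` cylinder w `&`
    [set t | (lower w + m (false :: w) <= t)%R = b].
Proof.
apply/seteqP; split=> t /=; rewrite cylinder_cons => -[];
  rewrite !quantile_cylinder /quantile => wE; rewrite ?wE => h; split=> //;
  by rewrite ?quantile_cylinder// wE.
Qed.

Lemma measurable_quantile : measurable_fun setT quantile.
Proof.
apply: (@measurability _ _ R leftword setT quantile cylinders) => //.
move=> _ [_ [w _ <-] <-]; rewrite setTI; elim: w => [|b w IH].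
  by rewrite cylinder_nil preimage_setT.
rewrite quantile_preimage_cons; apply: measurableI => //.
set c := (lower w + _)%R.
case: b.
  have -> : [set t | (c <= t)%R = true] = `[c, +oo[%classic.
    by apply/seteqP; split=> t; rewrite /= in_itv /= andbT.
  exact: measurable_itv.
have -> : [set t | (c <= t)%R = false] = `]-oo, c[%classic.
  apply/seteqP; split=> t; rewrite /= in_itv /= ltNge; first by move=> ->.
  by move/negbTE.
exact: measurable_itv.
Qed.

(** The parameters in the unit interval that are mapped to words ending in w are
those of the interval of w, whose length is m w.  Outside the unit interval the
map still has values, hence the intersection. *)
Lemma quantile_cylinder_itv w :
  [/\ (0 <= lower w)%R, (lower w + m w <= 1)%R &
    quantile @^-1` cylinder w `&` `[0%R, 1%R[%classic =
      `[lower w, (lower w + m w)%R[%classic].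
Proof.
elim: w => [|b w [lo0 hi1 IH]].
  by rewrite /= m_nil add0r cylinder_nil preimage_setT setTI.
have f0 := m_ge0 (false :: w); have t0 := m_ge0 (true :: w).
rewrite quantile_preimage_cons setIAC IH; rewrite m_cons in hi1 *.
case: b => /=; rewrite ?addr0; (split; [lra|lra|]).
  apply/seteqP; split=> t; rewrite /= !in_itv /=.
    by case=> /andP[h1 h2] ->; rewrite -addrA.
  by move=> /andP[h1 h2]; split=> //; apply/andP; split; lra.
apply/seteqP; split=> t; rewrite /= !in_itv /=.
  by case=> /andP[h1 h2] /negbT; rewrite -ltNge => ->; rewrite h1.
move=> /andP[h1 h2]; split; first by apply/andP; split; lra.
by apply/negbTE; rewrite -ltNge.
Qed.

Theorem cylinder_extension : exists mu : {measure set leftword -> \bar R},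
  forall w, mu (cylinder w) = (m w)%:E.
Proof.
have mI : measurable (`[0%R, 1%R[%classic : set (measurableTypeR R)).
  exact: measurable_itv.
have [mu muE] :=
  image_measure (mrestr lebesgue_measure mI) _ measurable_quantile.
exists mu => w; rewrite muE; have [_ _ wE] := quantile_cylinder_itv w.
transitivity (lebesgue_measure `[lower w, (lower w + m w)%R[%classic).
  by rewrite -wE.
rewrite lebesgue_measure_itv /= lte_fin.
case: ltP => h; first by rewrite -EFinB addrC addKr.
by congr EFin; have := m_ge0 w; lra.
Qed.

End extension.

(** * The states of the chain *)

Definition zeros : leftword := fun=> false.
Definition ones : leftword := fun=> true.

Lemma append_ones : append ones true = ones.
Proof. by apply/funext; case. Qed.

(** The words s, s10, s1010, ..., between two repetitions of a letter. *)
Definition rung (s : leftword) (k : nat) : leftword :=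
  iter k (fun t => append (append t true) false) s.

Lemma rung_last s k : s 0%N = false -> rung s k 0%N = false.
Proof. by case: k. Qed.

Lemma pref_ones : pref ones = Leaf1 0.
Proof. by apply/ctxP/ctx1_0. Qed.

Lemma pref_append_true s : pref (append s true) = Leaf1 0.
Proof. by apply/ctxP/ctx1_0. Qed.

Lemma pref_rung00 k : pref (rung zeros k) = Leaf00 k.
Proof.
apply/ctxP; elim: k => [|k IH]; first exact/ctx00_0.
by apply/ctx00S; split.
Qed.

Lemma pref_rung1 k : pref (rung (append ones false) k) = Leaf1 k.+1.
Proof.
by apply/ctxP; elim: k => [|k IH]; apply/ctx1S; split.
Qed.

(** The contexts contain no repeated letter except at their far end, so what
precedes a repetition never influences the letters to come.  This is how the
chain reduces to countably many states. *)
Definition same_recent (s s' : leftword) : Prop :=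
  exists2 j, s j = s j.+1 & forall i, (i <= j.+1)%N -> s' i = s i.

Lemma same_recent_append s s' a :
  same_recent s s' -> same_recent (append s a) (append s' a).
Proof. by case=> j sj h; exists j.+1 => //; case=> // i; exact: h. Qed.

Lemma same_recent_pref s s' : same_recent s s' -> pref s' = pref s.
Proof.
case=> j sj h; apply: pref_unique; have := prefP s.
have size_pow n : size (pow01 n) = n.*2 by elim: n => //= n ->.
have pfx w : (size w <= j.+2)%N -> rev_prefix w s -> rev_prefix w s'.
  rewrite /rev_prefix => wj <-; rewrite size_mkseq.
  apply/eq_in_map => i; rewrite mem_iota /= add0n => iw; apply: h.
  by rewrite -ltnS (leq_trans iw).
(* A repetition cannot occur where the word alternates. *)
have far m : (forall i, (i < m)%N -> s i = odd i) -> (m <= j.+1)%N.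
  move=> hm; rewrite leqNgt; apply/negP => jm; have := sj.
  by rewrite !hm//= 1?ltnW//; case: odd.
case: (pref s) => [n|n|] hs; have := leaf_first_diff hs => /=.
- by case=> /far le _; apply: pfx => //; rewrite size_cat size_pow addn1 ltnS.
- by case=> /far le _; apply: pfx => //; rewrite size_cat size_pow addn2 ltnS.
- by move=> sE; have := far j.+2 (fun i _ => sE i); rewrite ltnn.
Qed.

Section weights.
Context {R : realType} (q : bamboo -> probability bool R).
Local Notation p := (qval q (Leaf1 0) false).

(** The probability that the chain started at s appends the letters of w. *)
Fixpoint path_weight (s : leftword) (w : seq bool) : R :=
  if w is b :: w' then qval q (pref s) b * path_weight (append s b) w' else 1.

Lemma path_weight_rcons s w a : path_weight s (rcons w a) =
  path_weight s w * qval q (pref (foldl append s w)) a.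
Proof.
elim: w s => [|b w IH] s /=; first by rewrite mulr1 mul1r.
by rewrite IH mulrA.
Qed.

Lemma cylinder_foldl s w : cylinder w (foldl append s w).
Proof.
elim/last_ind: w => [|w a IH]; first by rewrite cylinder_nil.
by rewrite foldl_rcons; apply/cylinder_rcons.
Qed.

Definition unit_valued (f : leftword -> R) := forall s, 0 <= f s <= 1.

(** The functions of the state. *)
Definition forgetful (f : leftword -> R) :=
  forall s s', same_recent s s' -> f s' = f s.

Definition step (f : leftword -> R) (s : leftword) : R :=
  qval q (pref s) false * f (append s false) +
  qval q (pref s) true * f (append s true).

Lemma unit_path_weight w : unit_valued (path_weight^~ w).
Proof.
elim: w => [|b w IH] s /=; first by rewrite ler01 lexx.
have /andP[h0 h1] := IH (append s b); rewrite mulr_ge0 ?qval_ge0//=.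
by rewrite mulr_ile1 ?qval_ge0 ?qval_le1.
Qed.

Lemma forgetful_path_weight w : forgetful (path_weight^~ w).
Proof.
elim: w => // b w IH s s' ss' /=.
by rewrite (same_recent_pref _ _ ss') (IH _ _ (same_recent_append _ _ b ss')).
Qed.

Section ladder.
Variables (a : nat -> R) (s : leftword).
Hypothesis s0 : s 0%N = false.
Local Notation r k := (qval q (pref (rung s k)) true).
Hypothesis aS : forall k, a k.+1 = p * (r k * a k).

Definition ladder_term (f : leftword -> R) (k : nat) : R :=
  a k * (f (rung s k) + r k * f (append (rung s k) true)).

(** From the rung s(10)^k the chain either repeats the letter 0, or appends 1;
then it either repeats 1, or appends 0 and reaches the next rung.  The weights
a_k propagate along the rungs, so the two sides differ by a telescoping sum and
by the mass that leaves the ladder, which restarts from 00 or from 11.  A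
forgetful function has the value f zeros at each word ending in 00 and f ones
at each word ending in 11. *)
Lemma ladder_step f n : forgetful f ->
  series (ladder_term (step f)) n = series (ladder_term f) n +
    (a n * f (rung s n) - a 0%N * f s) +
    f zeros * series (fun k => a k - a k * r k) n +
    (1 - p) * f ones * series (fun k => a k * r k) n.
Proof.
move=> ff; elim: n => [|n IH].
  by rewrite /series /= !big_geq//; ring.
rewrite !seriesSr IH {IH} /ladder_term /step pref_append_true.
have -> : f (append (rung s n) false) = f zeros.
  by apply: ff; exists 0%N => // -[//|[|//]] _ /=; rewrite rung_last.
have -> : f (append (append (rung s n) true) true) = f ones.
  by apply: ff; exists 0%N => // -[//|[|//]].
rewrite aS (qval_false q (pref (rung s n))) (qval_true q (Leaf1 0)).
rewrite -[append (append _ _) _]/(rung s n.+1).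
set r0 := r n; set p0 := p.
move: (series _ n) (series _ n) (series _ n) => S0 S1 S2.
move: (f _) (f _) (f _) (f _) (f _) (f _) => f0 f1 f2 f3 f4 f5.
move: p0 r0 (a n) (a 0%N) => p0 r0 a0 a1.
ring.
Qed.

End ladder.
End weights.

(** * Construction of stationary measures *)

Lemma eseries_EFin {R : realType} (u : nat -> R) (l : R) :
  series u @ \oo --> l -> (\sum_(0 <= n <oo) (u n)%:E = l%:E)%E.
Proof.
move=> ul; transitivity (limn (EFin \o series u)).
  by congr (limn _); apply/funext => n; rewrite /= sumEFin.
by rewrite EFin_lim; [rewrite (cvg_lim _ ul)|apply/cvg_ex; exists l].
Qed.

Section functional.
Context {R : realType} (q : bamboo -> probability bool R).
Local Notation p := (qval q (Leaf1 0) false).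
Variables x y T1 T00 : R.
Hypotheses (x0 : 0 <= x) (y0 : 0 <= y).
Hypothesis cvg1 : series (cfun1 q) @ \oo --> T1.
Hypothesis cvg00 : series (cfun00 q) @ \oo --> T00.
Hypothesis letters : y + x * (1 + p) = 1.
Hypothesis contexts : x * T1 + y * T00 = 1.
(* If p = 0 then no mass leaves the words ending in 1, while y q_00(1) enters
   them; the two equations do not force this to be zero. *)
Hypothesis degenerate : p = 0 -> y * qval q (Leaf00 0) true = 0.

(* Masses of the contexts (01)^n 00 and (01)^(n+1) 1. *)
Let a00 n := y * cfun00 q n.
Let a1 n := x * cfun1 q n.+1.
Let total n := a00 n + a1 n.
(* The part of that mass that is followed by the letter 1. *)
Let up n := a00 n * qval q (Leaf00 n) true + a1 n * qval q (Leaf1 n.+1) true.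

(* There are two ladders, starting from 00 and from 110. *)
Let term f n := ladder_term q a00 zeros f n +
  ladder_term q a1 (append ones false) f n.

(* The invariant law, seen as an integral of functions of the state.  The words
   ending in 11 are represented by [ones]; their mass is that of the words ending
   in 1 times q_1(1). *)
Let Lambda f := (1 - p) * x * f ones + limn (series (term f)).

Let a00S n : a00 n.+1 = p * (qval q (pref (rung zeros n)) true * a00 n).
Proof. by rewrite pref_rung00 /a00 cfun00S; ring. Qed.

Let a1S n :
  a1 n.+1 = p * (qval q (pref (rung (append ones false) n)) true * a1 n).
Proof. by rewrite pref_rung1 /a1 cfun1S; ring. Qed.

Let a00_ge0 n : 0 <= a00 n. Proof. by rewrite mulr_ge0// cfun00_ge0. Qed.
Let a1_ge0 n : 0 <= a1 n. Proof. by rewrite mulr_ge0// cfun1_ge0. Qed.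

Let a00_0 : a00 0%N = y. Proof. by rewrite /a00 cfun00_0 mulr1. Qed.

Let a1_0 : a1 0%N = x * p * (1 - p).
Proof. by rewrite /a1 cfun1S cfun1_0 qval_true; ring. Qed.

Let yE : y = 1 - x * (1 + p).
Proof. exact: (canRL (addrK _) letters). Qed.

Let cvg_total : series total @ \oo --> 1 - x.
Proof.
have -> : series total = (fun n => y * series (cfun00 q) n +
    x * (series (cfun1 q) n.+1 - 1)).
  apply/funext; elim=> [|n IH].
    by rewrite seriesS /series /= !big_geq// cfun1_0; ring.
  by rewrite [in LHS]seriesSr IH !seriesSr /total /a00 /a1; ring.
have -> : 1 - x = y * T00 + x * (T1 - 1) by move: contexts; lra.
apply: cvgD; first exact: cvgMr.
apply: cvgMr; apply: cvgB; last exact: cvg_cst.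
by rewrite (cvg_shiftS (series (cfun1 q))).
Qed.

Let total_cvg0 : total @ \oo --> 0.
Proof. by apply: cvg_series_cvg_0; apply/cvg_ex; eexists; exact: cvg_total. Qed.

Let up_total n : p * up n = total n.+1.
Proof. by rewrite /total a00S a1S pref_rung00 pref_rung1 /up; ring. Qed.

(* By [up_total], p times this limit is known; dividing by p needs p <> 0. *)
Let cvg_up : series up @ \oo --> x * p.
Proof.
have [p0|pn0] := eqVneq p 0.
  suff -> : up = cst 0.
    rewrite p0 mulr0 (_ : series _ = cst 0); first exact: cvg_cst.
    by apply/funext => n; rewrite /series /= big1.
  apply/funext => -[|n]; rewrite /up.
    by rewrite a00_0 degenerate// a1_0 p0 mulr0 !mul0r addr0.
  by rewrite a00S a1S p0 !mul0r addr0.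
have -> : series up = (fun n => p^-1 * (series total n.+1 - total 0%N)).
  apply/funext; elim=> [|n IH].
    by rewrite seriesS /series /= !big_geq//; ring.
  rewrite [in LHS]seriesSr IH [in RHS]seriesSr -up_total.
  by field.
have -> : x * p = p^-1 * (1 - x - total 0%N).
  have -> : total 0%N = 1 - x - x * p * p by rewrite /total a00_0 a1_0 yE; ring.
  by field.
apply: cvgMr; apply: cvgB; last exact: cvg_cst.
by rewrite (cvg_shiftS (series total)).
Qed.

Let cvg_down : series (fun n => total n - up n) @ \oo --> y.
Proof.
have -> : y = 1 - x - x * p by rewrite yE; ring.
have -> : series (fun n => total n - up n) = series total - series up.
  by rewrite -seriesN -seriesD.
exact: cvgB.
Qed.

Let termE f n : term f n = a00 n * f (rung zeros n) +
  a1 n * f (rung (append ones false) n) +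
  (a00 n * qval q (Leaf00 n) true * f (append (rung zeros n) true) +
   a1 n * qval q (Leaf1 n.+1) true *
     f (append (rung (append ones false) n) true)).
Proof. by rewrite /term /ladder_term pref_rung00 pref_rung1; ring. Qed.

Let term_ge0 f n : unit_valued f -> 0 <= term f n.
Proof.
move=> uf; have f0 s : 0 <= f s by have /andP[] := uf s.
by rewrite termE !addr_ge0 ?(a00_ge0, a1_ge0, f0, qval_ge0, mulr_ge0).
Qed.

Let cvg_term f : unit_valued f -> cvgn (series (term f)).
Proof.
move=> uf; apply: (@series_le_cvg _ _ (total + up)) => [n|n|n|].
- exact: term_ge0.
- by rewrite /GRing.add /= /up !addr_ge0 ?(a00_ge0, a1_ge0, qval_ge0, mulr_ge0).
- have f1 s u : 0 <= u -> u * f s <= u.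
    by move=> u0; rewrite ler_piMr//; have /andP[] := uf s.
  rewrite termE; apply: lerD; apply: lerD; apply: f1 => //;
  by rewrite mulr_ge0 ?qval_ge0.
- rewrite seriesD; apply: is_cvgD; apply/cvg_ex; eexists;
    [exact: cvg_total|exact: cvg_up].
Qed.

Let Lambda_ge0 f : unit_valued f -> 0 <= Lambda f.
Proof.
move=> uf; rewrite addr_ge0//.
  rewrite !mulr_ge0//; first by rewrite subr_ge0 qval_le1.
  by have /andP[] := uf ones.
apply: limr_ge; first exact: cvg_term.
by apply: nearW => n; apply: sumr_ge0 => k _; exact: term_ge0.
Qed.

Let eq_Lambda f g : f =1 g -> Lambda f = Lambda g.
Proof. by move=> /funext ->. Qed.

Let LambdaD f g : unit_valued f -> unit_valued g ->
  Lambda (fun s => f s + g s) = Lambda f + Lambda g.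
Proof.
move=> uf ug; rewrite /Lambda.
have -> : term (fun s => f s + g s) = term f + term g.
  by apply/funext => n; rewrite [in RHS]/GRing.add /= !termE; ring.
rewrite seriesD limD; [|exact: cvg_term|exact: cvg_term].
ring.
Qed.

Let LambdaZ c f : unit_valued f -> Lambda (fun s => c * f s) = c * Lambda f.
Proof.
move=> uf; rewrite /Lambda.
have -> : term (fun s => c * f s) = c *: term f.
  apply/funext => n; rewrite [in RHS]/GRing.scale /= !termE.
  by rewrite -[RHS]/(c * _); ring.
rewrite lim_seriesZ; last exact: cvg_term.
rewrite -[c *: _]/(c * _).
ring.
Qed.

Let Lambda1 : Lambda (fun=> 1) = 1.
Proof.
rewrite /Lambda (_ : term _ = total + up); last first.
  by apply/funext => n; rewrite termE [in RHS]/GRing.add /= /total /up; ring.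
rewrite seriesD (cvg_lim (@norm_hausdorff _ _) (cvgD cvg_total cvg_up)).
ring.
Qed.

Let Lambda_last1 : Lambda (fun s => (s 0%N)%:R) = x.
Proof.
rewrite /Lambda (_ : term _ = up); last first.
  apply/funext => n; rewrite termE /= !rung_last// !mulr0 !addr0 !mulr1.
  by rewrite add0r.
by rewrite (cvg_lim (@norm_hausdorff _ _) cvg_up) /=; ring.
Qed.

Let Lambda_step f : unit_valued f -> forgetful f -> Lambda (step q f) = Lambda f.
Proof.
move=> uf ff; rewrite /Lambda.
set s1 := append ones false.
pose last n := a00 n * f (rung zeros n) + a1 n * f (rung s1 n).
(* The mass on the last rungs disappears in the limit; the masses x p of [up] and
   y of the rest, put back on [ones] and [zeros], balance the initial terms. *)
have E n : series (term (step q f)) n = series (term f) n + last n +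
    f zeros * series (fun n => total n - up n) n +
    (1 - p) * f ones * series up n - (y * f zeros + a1 0%N * f s1).
  pose r s k := qval q (pref (rung s k)) true.
  have -> : series (fun n => total n - up n) n =
      series (fun k => a00 k - a00 k * r zeros k) n +
      series (fun k => a1 k - a1 k * r s1 k) n.
    rewrite -[RHS]/((series _ + series _) n) -seriesD; congr (series _ n).
    apply/funext => k.
    rewrite -[RHS]/((a00 k - a00 k * r zeros k) + (a1 k - a1 k * r s1 k)).
    by rewrite /r pref_rung00 pref_rung1 /total /up; ring.
  have -> : series up n = series (fun k => a00 k * r zeros k) n +
      series (fun k => a1 k * r s1 k) n.
    rewrite -[RHS]/((series _ + series _) n) -seriesD; congr (series _ n).
    apply/funext => k; rewrite -[RHS]/(a00 k * r zeros k + a1 k * r s1 k).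
    by rewrite /r pref_rung00 pref_rung1.
  have tE g : series (term g) n = series (ladder_term q a00 zeros g) n +
      series (ladder_term q a1 s1 g) n.
    by rewrite -[RHS]/((series _ + series _) n) -seriesD; congr (series _ n).
  rewrite !tE (ladder_step q a00 zeros erefl a00S f n ff).
  rewrite (ladder_step q a1 s1 erefl a1S f n ff) a00_0 /last.
  ring.
have cvg_last : last @ \oo --> 0.
  apply: (squeeze_cvgr _ (cvg_cst 0) total_cvg0).
  apply: nearW => n; rewrite /last /total.
  have f0 s : 0 <= f s by have /andP[] := uf s.
  have f1 s u : 0 <= u -> u * f s <= u.
    by move=> u0; rewrite ler_piMr//; have /andP[] := uf s.
  apply/andP; split; first by rewrite addr_ge0 ?(a00_ge0, a1_ge0, f0, mulr_ge0).
  by apply: lerD; exact: f1.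
have : series (term (step q f)) @ \oo --> limn (series (term f)) + 0 +
    f zeros * y + (1 - p) * f ones * (x * p) - (y * f zeros + a1 0%N * f s1).
  rewrite (_ : series _ = fun n => series (term f) n + last n +
    f zeros * series (fun n => total n - up n) n +
    (1 - p) * f ones * series up n - (y * f zeros + a1 0%N * f s1)); last first.
    by apply/funext => n; exact: E.
  apply: cvgB; last exact: cvg_cst.
  apply: cvgD; last by apply: cvgMr; exact: cvg_up.
  apply: cvgD; last by apply: cvgMr; exact: cvg_down.
  apply: cvgD; last exact: cvg_last.
  exact: cvg_term.
move=> /(cvg_lim (@norm_hausdorff _ _)) ->.
rewrite /step pref_ones append_ones a1_0 qval_true -/s1.
ring.
Qed.

(** Stationarity at a finite context holds on the cylinders inside it because
[path_weight] multiplies by q_c(a), and extends to all measurable sets by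
uniqueness of measures.  At the infinite context both masses vanish: z = 0
because the finite contexts exhaust the total mass, and the measure is
invariant under deletion of the last letter. *)
Lemma stationary_existence :
  exists2 mu : {measure set leftword -> \bar R}, stationary_probability q mu &
    mu (ctx (Leaf1 0)) = x%:E /\ mu [set w10] = 0%E.
Proof.
pose m w := Lambda ((path_weight q)^~ w).
have uP w := unit_path_weight q w.
have fP w := forgetful_path_weight q w.
have [mu muE] : exists mu : {measure set leftword -> \bar R},
    forall w, mu (cylinder w) = (m w)%:E.
  apply: cylinder_extension => [w||w]; [exact: Lambda_ge0|exact: Lambda1|].
  by rewrite /m -LambdaD// -(Lambda_step _ (uP w) (fP w)).
have mu1 : mu setT = 1%E by rewrite -cylinder_nil muE /m Lambda1.
have mux : mu (ctx (Leaf1 0)) = x%:E.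
  rewrite ctx_cylinder// muE -Lambda_last1 /m; congr EFin.
  rewrite -[RHS]Lambda_step.
  - apply: eq_Lambda => s /=; rewrite /step /= mulr0 add0r.
    by [].
  - by move=> s; case: (s 0%N); rewrite /= ?ler01 lexx.
  - by move=> s s' [j _ h]; rewrite h.
have st c : c <> LeafInf -> stationary_at q mu c.
  move=> cinf a B mB Bc.
  have rcE w : cylinder w `<=` ctx c ->
      mu (ext a (cylinder w)) = ((qval q c a)%:E * mu (cylinder w))%E.
    move=> wc; rewrite -cylinder_ext !muE -EFinM -LambdaZ//; congr EFin.
    apply: eq_Lambda => s; rewrite path_weight_rcons mulrC.
    by congr (qval _ _ _ * _); apply/ctxP/wc; exact: cylinder_foldl.
  (* Both sides of the claim, as measures in B. *)
  have [m1 m1E] := image_measure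
    (mrestr mu (measurable_ext a _ (measurable_ctx c))) chop measurable_chop.
  pose m2 : {measure set leftword -> \bar R} :=
    mscale (NngNum (qval_ge0 q c a)) (mrestr mu (measurable_ctx c)).
  have m1X A : m1 A = mu (ext a (A `&` ctx c)).
    rewrite m1E /mrestr; congr (mu _).
    by apply/seteqP; split=> s; [case=> cs [s0 sc]|case=> s0 [cs sc]]; do !split.
  have m2X A : m2 A = ((qval q c a)%:E * mu (A `&` ctx c))%E by [].
  have m12 : same_measure m1 m2.
    apply: cylinder_measure_unique => [|w].
      rewrite m1X setTI ltey_eq (fin_mass mu mu1)//.
      exact: measurable_ext.
    rewrite m1X m2X; have [->|[w' -> w'c]] := cylinder_ctx w c cinf.
      rewrite measure0 mule0 (_ : ext a set0 = set0) ?measure0//.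
      by apply/seteqP; split=> // s [].
    exact: rcE.
  by have := m12 B mB; rewrite m1X m2X; move/setIidPl : Bc => ->.
have invariant : forall A, measurable A -> mu (chop @^-1` A) = mu A.
  have [nu nuE] := image_measure mu chop measurable_chop.
  move=> A mA; rewrite -nuE; apply: cylinder_measure_unique A mA => [|w].
    by rewrite nuE preimage_setT mu1 ltry.
  rewrite nuE chop_preimage_cylinder.
  transitivity (mu (cylinder (rcons w false)) + mu (cylinder (rcons w true)))%E.
    apply: measureU => //; apply/seteqP; split=> // s.
    by case=> /cylinder_rcons[s0 _] /cylinder_rcons[]; rewrite s0.
  rewrite !muE -EFinD -LambdaD//; congr EFin; apply: eq_Lambda => s.
  by rewrite !path_weight_rcons -mulrDr qval_sum mulr1.
have mu0 : mu [set w10] = 0%E.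
  have f0 : mu (ctx (Leaf00 0)) \is a fin_num by exact: fin_mass.
  have fi : mu [set w10] \is a fin_num.
    exact: (fin_mass mu mu1 _ (measurable_ctx LeafInf)).
  have := mass_contexts q mu st mu1; have := mass_letters q mu st mu1.
  rewrite /S1 /S00 (eseries_EFin _ _ cvg1) (eseries_EFin _ _ cvg00) mux.
  rewrite -(fineK f0) -(fineK fi) -!EFinM -!EFinD => -[e1] [e2].
  congr EFin; have y_eq : fine (mu (ctx (Leaf00 0))) = y.
    by rewrite yE; exact: (canRL (addrK _) (esym e1)).
  by move: e2; rewrite y_eq contexts; lra.
exists mu => //; apply/stationary_atP; split=> // c.
have [->|/st//] := pselect (c = LeafInf).
move=> a B mB Bw.
have muB : mu B = 0%E.
  apply/eqP; rewrite eq_le measure_ge0 andbT -mu0 le_measure ?inE//.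
  exact: (measurable_ctx LeafInf).
rewrite muB mule0; apply/eqP; rewrite eq_le measure_ge0 andbT -muB -(invariant B)//.
apply: le_measure => [||s []//]; rewrite inE; first exact: measurable_ext.
by rewrite -[X in measurable X]setTI; exact: measurable_chop.
Qed.

End functional.

(** * The sums S(1) and S(00), and uniqueness *)

Lemma cvg_bounded_series {R : realType} (u : nat -> R) (M : R) :
  (forall n, 0 <= u n) -> (forall n, series u n <= M) ->
  exists l, [/\ series u @ \oo --> l, u 0%N <= l & l <= M].
Proof.
move=> u0 uM; have nd : nondecreasing_seq (series u).
  exact: nondecreasing_series.
have cu : cvgn (series u).
  by apply: nondecreasing_is_cvgn => //; exists M => _ [n _ <-].
exists (limn (series u)); split=> //.
- have := nondecreasing_cvgn_le nd cu 1%N.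
  by rewrite seriesSr /series /= big_geq// add0r.
- by apply: limr_le => //; exact: nearW.
Qed.

Section bounds.
Context {R : realType} (q : bamboo -> probability bool R).
Local Notation p := (qval q (Leaf1 0) false).

Lemma cfun1_le n : cfun1 q n.+1 <= p ^+ n.+1 * (1 - p).
Proof.
elim: n => [|n IH].
  by rewrite cfun1S cfun1_0 qval_true mulr1 expr1.
rewrite cfun1S exprS -mulrA ler_wpM2l ?qval_ge0// (le_trans _ IH)//.
by rewrite ler_piMl ?cfun1_ge0 ?qval_le1.
Qed.

(** The first factor of the product in c_n(1) is q_1(1) = 1 - p, which makes the
bound on the partial sums telescope. *)
Lemma series_cfun1_le n : series (cfun1 q) n.+1 <= 1 + p - p ^+ n.+1.
Proof.
elim: n => [|n IH].
  by rewrite seriesSr /series /= big_geq// cfun1_0 expr1; lra.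
rewrite seriesSr [p ^+ n.+2]exprS; have := cfun1_le n; move: IH.
by move: (series _ _) (cfun1 _ _) (p ^+ _) => s c u; lra.
Qed.

Lemma S1_cvg : exists T1, [/\ series (cfun1 q) @ \oo --> T1, S1 q = T1%:E,
  1 <= T1, T1 <= 1 + p & (p = 1 -> T1 = 1)].
Proof.
have p0 := qval_ge0 q (Leaf1 0) false.
have le1p n : series (cfun1 q) n <= 1 + p.
  case: n => [|n]; first by rewrite /series /= big_geq//; lra.
  by have := series_cfun1_le n; have := exprn_ge0 n.+1 p0; lra.
have [T1 [cT1 lo hi]] := cvg_bounded_series _ _ (cfun1_ge0 q) le1p.
rewrite cfun1_0 in lo; exists T1; split=> //; first exact: eseries_EFin.
move=> p1; apply/eqP; rewrite eq_le lo andbT.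
rewrite -(cvg_lim (@norm_hausdorff _ _) cT1); apply: limr_le.
  by apply/cvg_ex; exists T1.
apply: nearW => -[|n]; first by rewrite /series /= big_geq.
by have := series_cfun1_le n; rewrite p1 expr1n; lra.
Qed.

Lemma series_cfun00_le n : (1 - p) * series (cfun00 q) n <= 1 - p ^+ n.
Proof.
have c_le k : cfun00 q k <= p ^+ k.
  rewrite /cfun00 ler_piMr ?exprn_ge0 ?qval_ge0//.
  by apply: prodr_ile1 => i _; rewrite qval_ge0 qval_le1.
elim: n => [|n IH]; first by rewrite /series /= big_geq// expr0; lra.
have := c_le n; have := qval_le1 q (Leaf1 0) false.
rewrite seriesSr exprS; move: (cfun00 q n) (p ^+ n) (series _ n) IH => c pn s.
by move: p => r; nra.
Qed.

Lemma S00_cvg : p < 1 -> exists T00, [/\ series (cfun00 q) @ \oo --> T00,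
  S00 q = T00%:E, 1 <= T00 & (p = 0 -> T00 = 1)].
Proof.
move=> p1; have p0 := qval_ge0 q (Leaf1 0) false.
have hi n : series (cfun00 q) n <= (1 - p)^-1.
  rewrite -[leRHS]mul1r ler_pdivlMr; last by lra.
  rewrite mulrC; have := series_cfun00_le n; have := exprn_ge0 n p0; lra.
have [T [cT lo T1]] := cvg_bounded_series _ _ (cfun00_ge0 q) hi.
rewrite cfun00_0 in lo; exists T; split=> //; first exact: eseries_EFin.
by move=> pE; move: T1; rewrite pE subr0 invr1; lra.
Qed.

Lemma S00_fin : (S00 q < +oo)%E -> exists T00,
  [/\ series (cfun00 q) @ \oo --> T00, S00 q = T00%:E & 1 <= T00].
Proof.
move=> Soo; have c := nnseries_is_cvg (cfun00_ge0 q) Soo.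
exists (limn (series (cfun00 q))); split=> //; first exact: eseries_EFin.
have nd : nondecreasing_seq (series (cfun00 q)).
  by apply: nondecreasing_series => n _ _; exact: cfun00_ge0.
have := nondecreasing_cvgn_le nd c 1%N.
by rewrite seriesSr /series /= big_geq// add0r cfun00_0.
Qed.

Section masses.
Variables T1 T00 : R.
Hypotheses (S1E : S1 q = T1%:E) (S00E : S00 q = T00%:E).
Local Notation det := (T1 - T00 * (1 + p)).

Lemma stationary_masses mu : stationary_probability q mu ->
  exists x z, [/\ mu (ctx (Leaf1 0)) = x%:E, mu [set w10] = z%:E,
    x * (1 + p) <= 1 & x * det = 1 - T00 - z].
Proof.
move=> /stationary_atP[mu1 st].
have st' c : c <> LeafInf -> stationary_at q mu c by move=> _; exact: st.
have fi : mu [set w10] \is a fin_num.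
  exact: (fin_mass mu mu1 _ (measurable_ctx LeafInf)).
have f c : mu (ctx c) \is a fin_num by exact: fin_mass.
exists (fine (mu (ctx (Leaf1 0)))), (fine (mu [set w10])).
rewrite !fineK//; split=> //.
  rewrite -lee_fin EFinM fineK// (mass_letters q mu st' mu1).
  by rewrite leeDr.
have := mass_contexts q mu st' mu1; have := mass_letters q mu st' mu1.
rewrite S1E S00E -(fineK fi) -(fineK (f (Leaf1 0))) -(fineK (f (Leaf00 0))).
rewrite -!EFinM -!EFinD => -[e1] [e2].
have yE := canRL (addrK _) (esym e1).
by move: e2; rewrite yE /=; move: (fine _) (fine _) p => x z r; lra.
Qed.

Lemma unique_stationary mu nu : det != 0 ->
  stationary_probability q mu -> stationary_probability q nu ->
  mu [set w10] = nu [set w10] -> same_measure mu nu.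
Proof.
move=> d0 stm stn; have [x [z [mx mz _ e]]] := stationary_masses mu stm.
have [x' [z' [nx nz _ e']]] := stationary_masses nu stn.
rewrite mz nz => -[zz]; apply: (same_masses q) => //; last by rewrite mz nz zz.
by rewrite mx nx; congr EFin; apply: (mulIf d0); rewrite e e' zz.
Qed.

Hypotheses (cvg1 : series (cfun1 q) @ \oo --> T1)
  (cvg00 : series (cfun00 q) @ \oo --> T00).
Hypotheses (T1_le : T1 <= 1 + p) (T00_ge : 1 <= T00).

(** If the determinant vanishes, equality holds in
T1 <= 1 + p <= T00 (1 + p). *)
Lemma det0 : det = 0 -> T00 = 1 /\ T1 = 1 + p.
Proof.
have p0 := qval_ge0 q (Leaf1 0) false => d.
have T00E : T00 = 1.
  apply/eqP; rewrite eq_le T00_ge andbT -(ler_pM2r (_ : 0 < 1 + p)).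
  by move: T1_le d; move: p => r h1 h2; rewrite mul1r; lra.
  lra.
by split=> //; move: d; rewrite T00E; lra.
Qed.

(** Cramer's rule for the two equations with z = 0; its solution is nonnegative
by the bounds on T1 and T00.  If p = 0 the determinant vanishes, and the choice
y = 0 avoids the degenerate case. *)
Lemma exists_stationary : (p = 0 -> T1 = T00) ->
  exists2 mu : {measure set leftword -> \bar R},
    stationary_probability q mu & mu [set w10] = 0%E.
Proof.
have p0 := qval_ge0 q (Leaf1 0) false => deg.
have [d|d] := eqVneq det 0.
  have [e00 e1] := det0 d.
  have [|||||mu st [_ mz]] := stationary_existence q (1 + p)^-1 0 T1 T00 _ _ cvg1 cvg00.
  - by rewrite invr_ge0; lra.
  - by [].
  - by field; lra.
  - by rewrite e1; field; lra.
  - by rewrite mul0r.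
  by exists mu.
have det_lt0 : 0 < - det.
  rewrite lt_neqAle oppr_ge0 eq_sym oppr_eq0 d /=.
  have : 1 + p <= T00 * (1 + p) by rewrite ler_peMl//; lra.
  by move: T1_le; lra.
have [|||||mu st [_ mz]] := stationary_existence q
  ((T00 - 1) / - det) ((1 + p - T1) / - det) T1 T00 _ _ cvg1 cvg00.
- by apply: divr_ge0; [rewrite subr_ge0|exact: ltW].
- by apply: divr_ge0; [rewrite subr_ge0|exact: ltW].
- by field; move: det_lt0; lra.
- by field; move: det_lt0; lra.
- by move=> pE; move: d; rewrite pE addr0 mulr1 deg// subrr eqxx.
by exists mu.
Qed.

End masses.

(** The side condition makes x = 0, y = 1 a stationary solution also when p = 0,
namely the measure concentrated at the word ...000. *)
Lemma unique_iff T1 T00 : p < 1 -> S1 q = T1%:E -> S00 q = T00%:E ->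
  series (cfun1 q) @ \oo --> T1 -> series (cfun00 q) @ \oo --> T00 ->
  T1 <= 1 + p -> 1 <= T00 -> p != 0 \/ qval q (Leaf00 0) true = 0 ->
  (forall mu nu, stationary_probability q mu ->
    stationary_probability q nu -> same_measure mu nu) <->
  T1 - T00 * (1 + p) != 0.
Proof.
move=> p1 S1E S00E cvg1 cvg00 T1_le T00_ge ne.
have p0 := qval_ge0 q (Leaf1 0) false; split=> [uniq|d mu nu stm stn].
  apply/negP => /eqP /(det0 T1 T00 T1_le T00_ge)[e00 e1].
  have [|||||mu stm [mx _]] := stationary_existence q (1 + p)^-1 0 T1 T00 _ _ cvg1 cvg00.
  - by rewrite invr_ge0; lra.
  - by [].
  - by field; lra.
  - by rewrite e1; field; lra.
  - by rewrite mul0r.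
  have [|||||nu stn [nx _]] := stationary_existence q 0 1 T1 T00 _ _ cvg1 cvg00.
  - by [].
  - by [].
  - by rewrite mul0r addr0.
  - by rewrite mul0r add0r mul1r.
  - by move=> pE; rewrite mul1r; case: ne => //; rewrite pE eqxx.
  have := uniq _ _ stm stn _ (measurable_ctx (Leaf1 0)); rewrite mx nx => -[].
  by move/eqP; rewrite invr_eq0; apply/negP; lra.
have no_inf m : stationary_probability q m -> m [set w10] = 0%E.
  move=> /stationary_atP[m1 st].
  have fi : m [set w10] \is a fin_num.
    exact: (fin_mass m m1 _ (measurable_ctx LeafInf)).
  have := mass_inf q m (st _) (st _); rewrite -(fineK fi) -EFinM => -[e].
  congr EFin; move: e.
  have := qval_le1 q LeafInf true; have := qval_ge0 q LeafInf true.
  have : 0 <= fine (m [set w10]) by rewrite fine_ge0.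
  move: (fine _) (qval q LeafInf true) => z r z0 r0 r1 e.
  have /eqP : z * (1 - p * r) = 0 by rewrite mulrBr mulr1 [z * _]mulrC -e subrr.
  rewrite mulf_eq0 => /orP[/eqP//|/eqP h].
  by move: p p0 p1 h => u; nra.
by apply: (unique_stationary T1 T00) => //; rewrite !no_inf.
Qed.

End bounds.

(** * The case q_1(0) = 1 *)

Section alternating.
Context {R : realType} (q : bamboo -> probability bool R).
Implicit Types (mu nu : {measure set leftword -> \bar R}).
Local Notation p := (qval q (Leaf1 0) false).

Lemma chop_w10_1 : chop w10_1 = w10.
Proof. by apply/funext => n; rewrite /chop /w10_1 /= negbK. Qed.

Lemma half_halfE A : half_half R A =
  (2^-1 * \1_A w10 + 2^-1 * \1_A w10_1)%:E.
Proof.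
rewrite -[LHS]/(measure_add (mscale (2^-1 : R)%:nng%R \d_w10)
  (mscale (2^-1 : R)%:nng%R \d_w10_1) A).
by rewrite measure_addE /= /mscale /= !diracE -!EFinM -EFinD.
Qed.

Lemma half_half_inf : half_half R [set w10] = (2^-1)%:E.
Proof.
rewrite half_halfE !indicE mem_set// memNset ?mulr1 ?mulr0 ?addr0//.
by move=> /(congr1 (fun s : leftword => s 0%N)).
Qed.

Lemma half_half1 : half_half R (ctx (Leaf1 0)) = (2^-1)%:E.
Proof.
rewrite half_halfE !indicE memNset; last by move/ctx1_0.
by rewrite mem_set ?mulr1 ?mulr0 ?add0r//; exact/ctx1_0.
Qed.

(** The chain exchanges the two alternating words. *)
Lemma half_half_stationary : p = 1 -> qval q LeafInf true = 1 ->
  stationary_probability q (half_half R).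
Proof.
move=> p1 qi; apply/stationary_atP; split.
  by rewrite half_halfE !indicT /= !mulr1; congr EFin; lra.
move=> c a B mB Bc; rewrite !half_halfE -EFinM; congr EFin.
have e0 : \1_(ext a B) w10 = (a == false)%:R * \1_B w10_1 :> R.
  rewrite !indicE -natrM mulnb; congr ((nat_of_bool _)%:R); apply/idP/idP.
    by move=> /set_mem[<- Bs]; rewrite eqxx mem_set.
  by case/andP=> /eqP -> /set_mem Bs; apply/mem_set.
have e1 : \1_(ext a B) w10_1 = (a == true)%:R * \1_B w10 :> R.
  rewrite !indicE -natrM mulnb; congr ((nat_of_bool _)%:R); apply/idP/idP.
    by move=> /set_mem[<-]; rewrite chop_w10_1 => Bs; rewrite eqxx mem_set.
  by case/andP=> /eqP -> /set_mem Bs; apply/mem_set; split; rewrite ?chop_w10_1.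
rewrite e0 e1 {e0 e1}.
have [B0|B0] := pselect (B w10).
  have cE : c = LeafInf by have /ctxP <- := Bc _ B0; apply: pref_unique.
  have B1 : ~ B w10_1.
    by move=> /Bc; rewrite cE => /(congr1 (fun s : leftword => s 0%N)).
  rewrite (indicE _ B w10) mem_set// (indicE _ B w10_1) memNset// cE.
  by case: a; rewrite ?qval_false qi /=; ring.
have [B1|B1] := pselect (B w10_1).
  have cE : c = Leaf1 0 by have /ctxP <- := Bc _ B1; apply/ctxP/ctx1_0.
  rewrite (indicE _ B w10) memNset// (indicE _ B w10_1) mem_set// cE.
  by case: a; rewrite ?qval_true p1 /=; ring.
by rewrite !indicE !memNset// !mulr0 addr0 mulr0.
Qed.

(** The absolute values make this a measure for every real t. *)
Definition mixture (mu nu : {measure set leftword -> \bar R}) (t : R) :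
    {measure set leftword -> \bar R} :=
  measure_add (mscale (NngNum (normr_ge0 (1 - t))) mu)
    (mscale (NngNum (normr_ge0 t)) nu).

Lemma mixtureE mu nu t A :
  mixture mu nu t A = (`|1 - t|%:E * mu A + `|t|%:E * nu A)%E.
Proof.
rewrite -[LHS]/(measure_add (mscale (NngNum (normr_ge0 (1 - t))) mu)
  (mscale (NngNum (normr_ge0 t)) nu) A).
by rewrite measure_addE.
Qed.

Lemma mixture_stationary mu nu t : 0 <= t <= 1 ->
  stationary_probability q mu -> stationary_probability q nu ->
  stationary_probability q (mixture mu nu t).
Proof.
move=> /andP[t0 t1] /stationary_atP[mu1 stm] /stationary_atP[nu1 stn].
apply/stationary_atP; split=> [|c a B mB Bc]; rewrite !mixtureE.
  rewrite mu1 nu1 !mule1 -EFinD; congr EFin.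
  by rewrite !ger0_norm ?subr_ge0// subrK.
rewrite (stm c)// (stn c)// ge0_muleDr ?mule_ge0//.
by rewrite muleCA [X in (_ + X)%E]muleCA.
Qed.

Lemma mixture_continuous mu nu A : mu setT = 1%E -> nu setT = 1%E ->
  measurable A -> continuous (fun t => fine (mixture mu nu t A)).
Proof.
move=> mu1 nu1 mA.
have fm := fin_mass mu mu1 A mA; have fn := fin_mass nu nu1 A mA.
rewrite (_ : (fun t => _) = fun t => `|1 - t| * fine (mu A) + `|t| * fine (nu A)).
  move=> t; apply: cvgD; apply: cvgMl.
    by apply: cvg_norm; apply: cvgB; [exact: cvg_cst|exact: cvg_id].
  by apply: cvg_norm; exact: cvg_id.
by apply/funext => t; rewrite mixtureE -(fineK fm) -(fineK fn).
Qed.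

End alternating.


Local Open Scope ereal_scope.

Theorem proposition32 (R : realType) (q : bamboo -> probability bool R) :
  S1 q < +oo /\
  (* (i) *)
  (qval q (Leaf1 0) false != 1%R ->
    (exists mu, stationary_probability q mu) /\
    (qval q (Leaf1 0) false != 0%R \/ qval q (Leaf00 0) true = 0%R ->
      ((forall mu nu, stationary_probability q mu ->
          stationary_probability q nu -> same_measure mu nu) <->
       S1 q - S00 q * (1 + qval q (Leaf1 0) false)%:E != 0))) /\
  (* (ii) *)
  (qval q (Leaf1 0) false = 1%R -> qval q LeafInf true = 1%R ->
    (S00 q = +oo ->
      stationary_probability q (half_half R) /\
      forall mu, stationary_probability q mu -> same_measure mu (half_half R)) /\
    (S00 q < +oo ->
      one_parameter_family [set mu | stationary_probability q mu])).
Proof.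
have [T1 [cT1 S1E T1_ge T1_le T1_1]] := S1_cvg q.
have p0 := qval_ge0 q (Leaf1 0) false.
split; first by rewrite S1E ltry.
split=> [pn1|p1 qi].
  have p_lt1 : (qval q (Leaf1 0) false < 1)%R by rewrite lt_neqAle pn1 qval_le1.
  have [T00 [cT00 S00E T00_ge T00_1]] := S00_cvg q p_lt1.
  split.
    have [|mu stm _] := exists_stationary q T1 T00 cT1 cT00 T1_le T00_ge.
      by move=> pE; rewrite (T00_1 pE); move: T1_le T1_ge; rewrite pE; lra.
    by exists mu.
  rewrite S1E S00E -EFinM -EFinB eqe.
  exact: unique_iff.
have hh := half_half_stationary q p1 qi.
split=> [S00oo|S00oo].
  split=> // mu stm; have /stationary_atP[mu1 st] := stm.
  have st' c : c <> LeafInf -> stationary_at q mu c by move=> _; exact: st.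
  have fi : mu [set w10] \is a fin_num.
    exact: (fin_mass mu mu1 _ (measurable_ctx LeafInf)).
  have f c : mu (ctx c) \is a fin_num by exact: fin_mass.
  have := mass_contexts q mu st' mu1; have := mass_letters q mu st' mu1.
  (* Otherwise the contexts (01)^n 00 would have infinite total mass. *)
  have y0 : mu (ctx (Leaf00 0)) = 0.
    apply/eqP; rewrite eq_le measure_ge0 andbT leNgt; apply/negP => y_gt0.
    have := mass_contexts q mu st' mu1; rewrite S00oo gt0_muley// S1E.
    rewrite -(fineK fi) -(fineK (f (Leaf1 0))) -EFinM.
    by rewrite addey// addye.
  rewrite y0 mul0e adde0 add0e S1E T1_1// p1.
  rewrite -(fineK fi) -(fineK (f (Leaf1 0))) -!EFinM -!EFinD => -[e1] [e2].
  apply: (same_masses q) => //.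
    by rewrite half_half1 -(fineK (f (Leaf1 0))); congr EFin; lra.
  by rewrite half_half_inf -(fineK fi); congr EFin; lra.
have [T00 [cT00 S00E T00_ge]] := S00_fin q S00oo.
have [|nu stn nu0] := exists_stationary q T1 T00 cT1 cT00 T1_le T00_ge.
  by move=> pE; move: p1; rewrite pE => /eqP; rewrite eq_sym oner_eq0.
(* The mass of (10)^∞ is an affine coordinate on the family. *)
have zE t : (0 <= t <= 1)%R ->
    mixture (half_half R) nu t [set w10] = ((1 - t) / 2)%:E.
  move=> /andP[t0 t1]; rewrite mixtureE half_half_inf nu0 mule0 adde0 -EFinM.
  by rewrite ger0_norm// subr_ge0.
have det0 : (T1 - T00 * (1 + qval q (Leaf1 0) false) != 0)%R.
  by rewrite p1 T1_1//; move: T00_ge; clear; lra.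
move=> {nu0}; exists (mixture (half_half R) nu); split.
- by move=> t; rewrite in_itv /= => tI; exact: mixture_stationary.
- move=> t u; rewrite !in_itv /= => tI uI /(_ _ (measurable_ctx LeafInf)).
  by rewrite !zE// => -[]; lra.
- move=> A mA; apply: continuous_subspaceT.
  by apply: mixture_continuous => //; [have [] := hh|have [] := stn].
- move=> mu stm.
  have [x [z [mx mz x_le e]]] := stationary_masses q T1 T00 S1E S00E mu stm.
  have z0 : (0 <= z)%R by rewrite -lee_fin -mz measure_ge0.
  (* As y >= 0, the mass x is at most 1/2, and z increases with x. *)
  have z1 : (z <= 1 / 2)%R.
    by move: e x_le; rewrite p1 T1_1//; nra.
  have tI : (0 <= 1 - 2 * z <= 1)%R by apply/andP; split; lra.
  exists (1 - 2 * z)%R; first by rewrite in_itv.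
  apply: (unique_stationary q T1 T00) => //; first exact: mixture_stationary.
  by rewrite zE// mz; congr EFin; lra.
Qed.
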